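(* Let $\mathcal D$ be a brane diagram. There is a natural bijection between the tie diagrams of $\mathcal D$ and the binary contingency tables (BCTs) of the table-with-margins corresponding to $\mathcal D$.
   Context: A brane diagram $\mathcal D$ is a finite sequence of 5-branes arranged from left to right, each being either a D5 brane or an NS5 brane. The D3 branes are the intervals between consecutive 5-branes, together with one D3 brane to the left of all 5-branes and one to the right of all of them. Each D3 brane $X$ carries a multiplicity $d_X\in\mathbb Z_{\ge0}$; the two outer D3 branes have multiplicity $0$. The D5 branes $U_1,\dots,U_n$ and the NS5 branes $V_1,\dots,V_m$ are numbered left to right. For a 5-brane $W$, $W^-$ and $W^+$ are the D3 branes directly left and right of it. Put $r_i=d_{V_i^+}-d_{V_i^-}+\#\{\text{D5 branes left of }V_i\}$ and $c_j=d_{U_j^-}-d_{U_j^+}+\#\{\text{NS5 branes right of }U_j\}$; $r=(r_1,\dots,r_m)$ and $c=(c_1,\dots,c_n)$ are the margin vectors. Standing assumption, part of the definition of brane diagram: there exists at least one $m\times n$ $0$-$1$ matrix with row sums $r$ and column sums $c$. The table-with-margins of $\mathcal D$ consists of the matrix size $m\times n$ (rows labelled by $V_1,\dots,V_m$ from top to bottom, columns by $U_1,\dots,U_n$ from left to right), the margin vectors $r,c$, and the separating line: the down-and-right monotone lattice path from the NW corner to the SE corner of the table such that the $(V_i,U_j)$ box lies to the right of (equivalently, above) the path if and only if $V_i$ is left of $U_j$ in $\mathcal D$. A binary contingency table (BCT) with margins $r,c$ is an $m\times n$ matrix $M$ with entries in $\{0,1\}$ with $\sum_jM_{ij}=r_i$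 for all $i$ and $\sum_iM_{ij}=c_j$ for all $j$. The BCTs of a table-with-margins are the BCTs with its margin vectors $r,c$. A tie diagram of $\mathcal D$ is a set of pairs (ties), each consisting of one D5 brane and one NS5 brane, such that each D3 brane $X$ is covered by (lies between the two members of) exactly $d_X$ of the pairs. *)

(* Defs.v *)
From HB Require Import structures.
From mathcomp Require Import all_boot all_order all_algebra zify.

Set Implicit Arguments.
Unset Strict Implicit.
Unset Printing Implicit Defensive.

Variant step := Down | Right.

Definition is_down (s : step) : bool := if s is Down then true else false.
Definition is_right (s : step) : bool := if s is Right then true else false.

(* A lattice path from the NW to the SE corner is its list of unit steps. *)
Record table_with_margins := TableWithMargins {
  nrows : nat;
  ncols : nat;
  row_margin : 'I_nrows -> int;
  col_margin : 'I_ncols -> int;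
  sepline : seq step;
  sepline_down : count is_down sepline = nrows;
  sepline_right : count is_right sepline = ncols
}.

(* Abscissa of the vertical step with which the path [l] crosses row [i]
   (the NW corner has abscissa 0; rows are numbered from 0). *)
Fixpoint crossing (l : seq step) (i : nat) : nat :=
  match l with
  | [::] => 0
  | Right :: l' => (crossing l' i).+1
  | Down :: l' => if i is i'.+1 then crossing l' i' else 0
  end.

(* Box (i, j) occupies the abscissas from j to j + 1. *)
Definition right_of_path (l : seq step) (i j : nat) : bool := crossing l i <= j.

Lemma leq_crossing l i : crossing l i <= count is_right l.
Proof. by elim: l i => [|[] l IH] [|i] //=; rewrite ltnS. Qed.

Lemma path_uniq m n l1 l2 :
  count is_down l1 = m -> count is_right l1 = n ->
  count is_down l2 = m -> count is_right l2 = n ->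
  (forall i j, i < m -> j < n -> right_of_path l1 i j = right_of_path l2 i j) ->
  l1 = l2.
Proof.
move=> d1 r1 d2 r2 H.
have {}H i : i < m -> crossing l1 i = crossing l2 i.
  move=> im; have c1 := leq_crossing l1 i; have c2 := leq_crossing l2 i.
  rewrite r1 in c1; rewrite r2 in c2.
  case: (ltngtP (crossing l1 i) (crossing l2 i)) => // lt.
    have := H i _ im (leq_trans lt c2).
    by rewrite /right_of_path leqnn leqNgt lt.
  have := H i _ im (leq_trans lt c1).
  by rewrite /right_of_path leqnn leqNgt lt.
rewrite -{}d1 in d2 H; rewrite -{}r1 in r2.
elim: l1 l2 d2 r2 H => [|s1 l1 IH] [|s2 l2] //=; try by case: s2.
  by case: s1.
case: s1; case: s2 => //= d1 r1 H.
- by congr (_ :: _); apply: IH => [||i lt]; [lia | lia | apply: (H i.+1)].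
- by have := H 0 isT.
- by have /H : 0 < 0 + count is_down l1 by rewrite -d1.
- congr (_ :: _); apply: IH => [||i lt]; [lia | lia |].
  by apply: succn_inj; apply: H.
Qed.

Definition is_bct (t : table_with_margins)
    (M : 'M[bool]_(nrows t, ncols t)) : bool :=
  [forall i, Posz (\sum_j M i j) == row_margin i] &&
  [forall j, Posz (\sum_i M i j) == col_margin j].

Definition bct (t : table_with_margins) : Type :=
  {M : 'M[bool]_(nrows t, ncols t) | is_bct M}.

Variant fivebrane := D5 | NS5.

Definition is_D5 (b : fivebrane) : bool := if b is D5 then true else false.
Definition is_NS5 (b : fivebrane) : bool := if b is NS5 then true else false.

(* The 5-branes are at positions 0, ..., N - 1. The D3 branes are numbered
   0, ..., N from left to right: D3 brane k lies between the 5-branes at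
   positions k - 1 and k. *)
Record brane_data := BraneData {
  nbranes : nat;
  fivebranes : nbranes.-tuple fivebrane;
  mult : 'I_nbranes.+1 -> nat
}.

Section BraneData.
Variable D : brane_data.
Local Notation position := 'I_(nbranes D).
Local Notation D3 := 'I_(nbranes D).+1.

Definition D3_left (W : position) : D3 := lift ord_max W.
Definition D3_right (W : position) : D3 := lift ord0 W.

Lemma val_D3_left W : D3_left W = W :> nat. Proof. exact: lift_max. Qed.
Lemma val_D3_right W : D3_right W = W.+1 :> nat. Proof. exact: lift0. Qed.

Definition D5_positions : {set position} :=
  [set W | is_D5 (tnth (fivebranes D) W)].
Definition NS5_positions : {set position} :=
  [set W | is_NS5 (tnth (fivebranes D) W)].

Definition nD5 : nat := #|D5_positions|.
Definition nNS5 : nat := #|NS5_positions|.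

(* [enum_val] enumerates a set of ordinals increasingly (see [ltn_U] and
   [ltn_V]), so these are numbered from left to right, from 0. *)
Definition U (j : 'I_nD5) : position := enum_val j.
Definition V (i : 'I_nNS5) : position := enum_val i.

Definition D_row_margin (i : 'I_nNS5) : int :=
  (Posz (mult (D3_right (V i))) - Posz (mult (D3_left (V i)))
   + Posz #|[set j : 'I_nD5 | (U j < V i)%N]|)%R.

Definition D_col_margin (j : 'I_nD5) : int :=
  (Posz (mult (D3_left (U j))) - Posz (mult (D3_right (U j)))
   + Posz #|[set i : 'I_nNS5 | (U j < V i)%N]|)%R.

(* Reading the diagram from left to right, an NS5 brane is a step down along a
   row and a D5 brane is a step to the right along a column; [D_sepline_spec]
   and [D_sepline_uniq] show that this is the separating line. *)
Definition D_sepline : seq step :=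
  [seq if is_NS5 b then Down else Right | b <- fivebranes D].

Lemma ltn_enum_val n (A : {set 'I_n}) (i j : 'I_#|A|) :
  (enum_val i < enum_val j) = (i < j).
Proof.
have mono (a b : 'I_#|A|) : a < b -> enum_val a < enum_val b.
  move=> ab; have x0 : 'I_n := enum_val a.
  have sz (k : 'I_#|A|) : k < size (enum A) by rewrite -cardE.
  rewrite !(enum_val_nth x0) -!(nth_map x0 0 val) //.
  apply: (sorted_ltn_nth ltn_trans) => //; rewrite ?inE ?size_map //.
  rewrite /enum_mem -enumT; apply: (subseq_sorted ltn_trans).
    by apply: map_subseq; apply: filter_subseq.
  by rewrite val_enum_ord iota_ltn_sorted.
case: (ltngtP i j) => [/mono-> //|/mono lt|/val_inj->]; last by rewrite ltnn.
by rewrite ltnNge ltnW.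
Qed.

Lemma ltn_U (j1 j2 : 'I_nD5) : (U j1 < U j2) = (j1 < j2).
Proof. exact: ltn_enum_val. Qed.

Lemma ltn_V (i1 i2 : 'I_nNS5) : (V i1 < V i2) = (i1 < i2).
Proof. exact: ltn_enum_val. Qed.

Lemma D_sepline_down : count is_down D_sepline = nNS5.
Proof.
rewrite count_map /nNS5 cardsE cardE size_filter -enumT.
rewrite -[in LHS](map_tnth_enum (fivebranes D)) count_map.
by apply: eq_count => W /=; rewrite unfold_in; case: (tnth _ W).
Qed.

Lemma D_sepline_right : count is_right D_sepline = nD5.
Proof.
rewrite count_map /nD5 cardsE cardE size_filter -enumT.
rewrite -[in LHS](map_tnth_enum (fivebranes D)) count_map.
by apply: eq_count => W /=; rewrite unfold_in; case: (tnth _ W).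
Qed.

Lemma crossing_read (w : seq fivebrane) (x0 : fivebrane) (p i : nat) :
  p < size w -> is_NS5 (nth x0 w p) -> count is_NS5 (take p w) = i ->
  crossing [seq if is_NS5 b then Down else Right | b <- w] i
  = count is_D5 (take p w).
Proof.
elim: w p i => [|b w IH] [|p] i //=; first by case: b => // _ _ <-.
by rewrite ltnS => lt ns <-; case: b => /=; rewrite !add0n ?add1n (IH p).
Qed.

Lemma card_before (P : pred fivebrane) (p : 'I_(nbranes D)) :
  #|[set W : 'I_(nbranes D) | P (tnth (fivebranes D) W) & W < p]|
  = count P (take p (fivebranes D)).
Proof.
rewrite cardsE cardE size_filter -enumT.
have -> : take p (fivebranes D) =
    [seq tnth (fivebranes D) W | W <- [seq W : 'I_(nbranes D) <- enum 'I_(nbranes D) | W < p]].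
  have x0 : fivebrane := D5.
  rewrite -{1}(map_tnth_enum (fivebranes D)) -map_take; congr map.
  apply: (inj_map val_inj); rewrite map_take val_enum_ord take_iota.
  rewrite -(filter_map val (fun k => k < p)) val_enum_ord.
  have lep : p <= nbranes D by apply: ltnW.
  by rewrite (minn_idPl lep) -(filter_iota_ltn 0 lep).
rewrite count_map count_filter; apply: eq_count => W /=.
by rewrite unfold_in.
Qed.

Lemma card_enum_before (A : {set 'I_(nbranes D)}) (p : nat) :
  #|[set k : 'I_#|A| | enum_val k < p]| = #|[set W in A | W < p]|.
Proof.
rewrite -(card_imset _ enum_val_inj); apply: eq_card => W; rewrite inE.
apply/imsetP/andP => [[k kp ->]|[WA Wp]].
  by rewrite inE in kp; rewrite enum_valP.
by exists (enum_rank_in WA W); rewrite ?inE enum_rankK_in.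
Qed.

Lemma card_ltn_ord n (i : 'I_n) : #|[set k : 'I_n | k < i]| = i.
Proof.
have -> : [set k : 'I_n | k < i] = widen_ord (ltnW (ltn_ord i)) @: setT.
  apply/setP => k; rewrite inE; apply/idP/imsetP => [ki|[x _ ->]] /=.
    by exists (Ordinal ki) => //; apply: val_inj.
  exact: ltn_ord.
rewrite card_imset; first by rewrite cardsT card_ord.
by move=> x y /(congr1 val) /= /val_inj.
Qed.

Lemma D_sepline_spec (i : 'I_nNS5) (j : 'I_nD5) :
  right_of_path D_sepline i j = (V i < U j).
Proof.
have Vns : is_NS5 (tnth (fivebranes D) (V i)).
  by have := enum_valP i; rewrite inE.
rewrite /right_of_path (@crossing_read _ D5 (V i)).
- rewrite -card_before.
  have -> : [set W | is_D5 (tnth (fivebranes D) W) & W < V i] =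
            [set W in D5_positions | W < V i].
    by apply/setP => W; rewrite !inE.
  rewrite -card_enum_before.
  have neq : U j <> V i.
    move=> e; have := enum_valP j; rewrite inE -/(U j) e.
    by move: Vns; case: (tnth _ _).
  case: (ltngtP (V i) (U j)) => [lt|lt|/val_inj e]; last by case: neq.
    rewrite -[X in _ <= X](card_ltn_ord j); apply: subset_leq_card.
    apply/subsetP => k; rewrite !inE => kV.
    by rewrite -ltn_U; apply: ltn_trans lt.
  apply/negbTE; rewrite -ltnNge -{1}[val j]card_ltn_ord.
  apply: proper_card; apply/properP; split.
    apply/subsetP => k; rewrite !inE => kj.
    by apply: ltn_trans lt; rewrite ltn_U.
  by exists j; rewrite !inE ?ltnn.
- by rewrite size_tuple.
- by rewrite -tnth_nth.
rewrite -card_before.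
have -> : [set W | is_NS5 (tnth (fivebranes D) W) & W < V i] =
          [set W in NS5_positions | W < V i].
  by apply/setP => W; rewrite !inE.
rewrite -card_enum_before -[RHS](card_ltn_ord i).
by apply: eq_card => k; rewrite !inE ltn_V.
Qed.

Lemma D_sepline_uniq l :
  count is_down l = nNS5 -> count is_right l = nD5 ->
  (forall (i : 'I_nNS5) (j : 'I_nD5), right_of_path l i j = (V i < U j)) ->
  l = D_sepline.
Proof.
move=> dl rl H.
apply: (path_uniq dl rl D_sepline_down D_sepline_right) => i j im jn.
have /= -> := H (Ordinal im) (Ordinal jn).
by have /= -> := D_sepline_spec (Ordinal im) (Ordinal jn).
Qed.

Definition table_of : table_with_margins :=
  TableWithMargins D_row_margin D_col_margin D_sepline_down D_sepline_right.

(* D3 brane X is right of the 5-brane at position W iff W < X, and left of it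
   iff X <= W. *)
Definition covers (t : 'I_nD5 * 'I_nNS5) (X : D3) : bool :=
  (U t.1 < X <= V t.2) || (V t.2 < X <= U t.1).

Definition is_tie_diagram (T : {set 'I_nD5 * 'I_nNS5}) : bool :=
  [forall X : D3, #|[set t in T | covers t X]| == mult X].

Definition tie_diagram : Type :=
  {T : {set 'I_nD5 * 'I_nNS5} | is_tie_diagram T}.

End BraneData.

(* The two outer D3 branes coincide when there is no 5-brane. Margins are
   integers; the last field forces them to be nonnegative. *)
Record brane_diagram := BraneDiagram {
  diagram_data :> brane_data;
  mult_leftmost : mult (ord0 : 'I_(nbranes diagram_data).+1) = 0;
  mult_rightmost : mult (ord_max : 'I_(nbranes diagram_data).+1) = 0;
  bct_exists : exists M, is_bct (t := table_of diagram_data) M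
}.

(* Main.v *)
Require Import Defs.
From mathcomp Require Import all_boot all_order all_algebra zify.

(** A set of ties and a 0-1 matrix carry the same information: record each pair
    (U_j, V_i) by its membership in the set when V_i is left of U_j, and by the
    negation of its membership otherwise.  What has to be seen is that under
    this encoding the covering conditions at the D3 branes become the margin
    conditions.

    Compare the number of ties covering the two D3 branes next to an NS5 brane
    V_i.  Only the ties ending at V_i matter: those going to a D5 brane on the
    right cover V_i^+ but not V_i^-, those going to the left do the opposite.
    A tie to the left contributes -1 when present, which is the complemented
    entry minus 1; hence the i-th row sum of the matrix is the jump of the
    covering number at V_i plus the number of D5 branes left of V_i
    ([row_sum_jump]).  The margin r_i is given by the same formula with the
    prescribed multiplicities in place of the covering numbers, so the i-th row
    condition says that the two functions jump equally at V_i.  The columns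
    behave likewise at the D5 branes ([col_sum_jump]).  Therefore the matrix is
    a BCT exactly when the covering number and the multiplicity have the same
    jump at every 5-brane, and since both vanish on the leftmost D3 brane, this
    means that they agree everywhere ([is_bct_table]). *)

Set Implicit Arguments.
Unset Strict Implicit.
Unset Printing Implicit Defensive.

Lemma card_sum_nat_of_bool (I : finType) (P : pred I) :
  #|[set x | P x]| = \sum_x P x.
Proof.
by rewrite -sum1dep_card big_mkcond; apply: eq_bigr => x _; case: (P x).
Qed.

Section TiesAndTables.
Variable D : brane_data.
Implicit Types (T : {set 'I_(nD5 D) * 'I_(nNS5 D)}) (i : 'I_(nNS5 D))
  (j : 'I_(nD5 D)) (W : 'I_(nbranes D)) (X : 'I_(nbranes D).+1).

Lemma U_neq_V i j : U j != V i :> nat.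
Proof.
apply/eqP => /val_inj eUV.
have := enum_valP j; have := enum_valP i; rewrite !inE -/(U j) -/(V i) eUV.
by case: (tnth _ _).
Qed.

Lemma position_UV W : (exists j, W = U j) \/ (exists i, W = V i).
Proof.
case eW: (tnth (fivebranes D) W).
  have WD5 : W \in D5_positions D by rewrite inE eW.
  by left; exists (enum_rank_in WD5 W); rewrite /U enum_rankK_in.
have WNS5 : W \in NS5_positions D by rewrite inE eW.
by right; exists (enum_rank_in WNS5 W); rewrite /V enum_rankK_in.
Qed.

Definition covering T X : nat := #|[set t in T | covers t X]|.

Lemma coveringE T X :
  covering T X = \sum_j \sum_i (((j, i) \in T) && covers (j, i) X).
Proof.
rewrite pair_bigA /covering card_sum_nat_of_bool.
by apply: eq_bigr => -[j i].
Qed.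

Lemma covering_leftmost T : covering T ord0 = 0.
Proof.
by rewrite coveringE big1 // => j _; rewrite big1 // => i _;
  rewrite /covers andbF.
Qed.

(** A boolean equality with [V i < U j] keeps the membership of the tie above
    the separating line and negates it below; written this way the encoding is
    visibly an involution. *)
Definition table_of_ties T : 'M[bool]_(nNS5 D, nD5 D) :=
  \matrix_(i, j) ((V i < U j) == ((j, i) \in T)).

Definition ties_of_table (M : 'M[bool]_(nNS5 D, nD5 D)) :
    {set 'I_(nD5 D) * 'I_(nNS5 D)} :=
  [set t | (V t.2 < U t.1) == M t.2 t.1].

Lemma table_of_tiesK : cancel table_of_ties ties_of_table.
Proof.
move=> T; apply/setP => -[j i]; rewrite inE mxE /=.
by case: (V i < U j); case: (_ \in T).
Qed.

Lemma ties_of_tableK : cancel ties_of_table table_of_ties.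
Proof.
move=> M; apply/matrixP => i j; rewrite mxE inE /=.
by case: (V i < U j); case: (M i j).
Qed.

(** Ties with another NS5 end cover both or none of the neighbours of [V i], so
    the claim reduces to one identity for each tie [(j, i)]. *)
Lemma row_sum_jump T i :
  \sum_j table_of_ties T i j + covering T (D3_left (V i)) =
  covering T (D3_right (V i)) + #|[set j : 'I_(nD5 D) | U j < V i]|.
Proof.
rewrite !coveringE card_sum_nat_of_bool -!big_split /=.
apply: eq_bigr => j _; rewrite mxE !(bigD1 (P := xpredT) i) //=.
rewrite (eq_bigr (fun i' => nat_of_bool
    (((j, i') \in T) && covers (j, i') (D3_right (V i))))) => [|i' ne_i'i].
  rewrite /covers val_D3_left val_D3_right /=.
  by have := U_neq_V i j; case: (_ \in T) => /=; lia.
have neV : V i' != V i :> nat by rewrite (inj_eq val_inj) (inj_eq enum_val_inj).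
rewrite /covers val_D3_left val_D3_right /=.
by congr (nat_of_bool (_ && _)); have := U_neq_V i j; lia.
Qed.

(** Ties above the separating line start at their NS5 brane and end at their D5
    brane, when read from left to right; so the jump at a D5 brane is measured
    in the direction opposite to that of [row_sum_jump]. *)
Lemma col_sum_jump T j :
  \sum_i table_of_ties T i j + covering T (D3_right (U j)) =
  covering T (D3_left (U j)) + #|[set i : 'I_(nNS5 D) | U j < V i]|.
Proof.
have coveringE' X : covering T X =
    \sum_i \sum_j (((j, i) \in T) && covers (j, i) X).
  by rewrite coveringE exchange_big.
rewrite !coveringE' card_sum_nat_of_bool -!big_split /=.
apply: eq_bigr => i _; rewrite mxE !(bigD1 (P := xpredT) j) //=.
rewrite (eq_bigr (fun j' => nat_of_bool
    (((j', i) \in T) && covers (j', i) (D3_left (U j))))) => [|j' ne_j'j].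
  rewrite /covers val_D3_left val_D3_right /=.
  by have := U_neq_V i j; case: (_ \in T) => /=; lia.
have neU : U j' != U j :> nat by rewrite (inj_eq val_inj) (inj_eq enum_val_inj).
rewrite /covers val_D3_left val_D3_right /=.
by congr (nat_of_bool (_ && _)); have := U_neq_V i j; lia.
Qed.

(** The margins determine the multiplicities, once the leftmost one is known to
    vanish: walking from left to right, each 5-brane fixes the next one. *)
Lemma is_bct_table T : mult (ord0 : 'I_(nbranes D).+1) = 0 ->
  is_bct (t := table_of D) (table_of_ties T) = is_tie_diagram T.
Proof.
move=> mult0; apply/andP/forallP => [[/forallP rowT /forallP colT] | covT].
  have jump W : covering T (D3_left W) = mult (D3_left W) ->
                covering T (D3_right W) = mult (D3_right W).
    case: (position_UV W) => [[j ->]|[i ->]].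
      by have := col_sum_jump T j; have := eqP (colT j);
        rewrite /= /D_col_margin /=; lia.
    by have := row_sum_jump T i; have := eqP (rowT i);
      rewrite /= /D_row_margin /=; lia.
  suffices cov_mult k (lt_k : k < (nbranes D).+1) :
      covering T (Ordinal lt_k) = mult (Ordinal lt_k).
    by case=> k lt_k; apply/eqP; apply: cov_mult.
  elim: k lt_k => [|k IHk] lt_k.
    by rewrite (_ : Ordinal lt_k = ord0) ?covering_leftmost ?mult0 //;
      apply: ord_inj.
  pose W : 'I_(nbranes D) := Ordinal (lt_k : k < nbranes D).
  have -> : Ordinal lt_k = D3_right W by apply: ord_inj; rewrite val_D3_right.
  apply: jump.
  have -> : D3_left W = Ordinal (ltnW lt_k).
    by apply: ord_inj; rewrite val_D3_left.
  exact: IHk.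
have {}covT X : covering T X = mult X by apply/eqP; apply: covT.
split; apply/forallP => k; apply/eqP.
  by have := row_sum_jump T k; rewrite !covT /= /D_row_margin /=; lia.
by have := col_sum_jump T k; rewrite !covT /= /D_col_margin /=; lia.
Qed.

End TiesAndTables.

Theorem proposition4p5 (D : brane_diagram) :
  exists f : tie_diagram D -> bct (table_of D),
    bijective f /\
    forall (T : tie_diagram D) (i : 'I_(nNS5 D)) (j : 'I_(nD5 D)),
      val (f T) i j =
        if right_of_path (sepline (table_of D)) i j
        then (j, i) \in val T
        else (j, i) \notin val T.
Proof.
have bctE T := is_bct_table T (mult_leftmost D).
have bctP (T : tie_diagram D) :
    is_bct (t := table_of D) (table_of_ties (val T)).
  by rewrite bctE; apply: (valP T).
have tiesP (M : bct (table_of D)) :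
    is_tie_diagram (ties_of_table (D := D) (val M)).
  by rewrite -bctE ties_of_tableK; apply: (valP M).
exists (fun T => exist _ (table_of_ties (val T)) (bctP T)); split.
  exists (fun M => exist _ (ties_of_table (D := D) (val M)) (tiesP M)) => [T|M].
    by apply: val_inj; apply: table_of_tiesK.
  by apply: val_inj; apply: ties_of_tableK.
move=> T i j; rewrite /= mxE D_sepline_spec.
by case: (V i < U j); case: (_ \in _).
Qed.
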